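(* Let $G$ be a finite, simple, undirected, connected graph on $n$ vertices. Let $\bigwedge^{k}G$ denote its exterior $k$th power, which is a signed graph. (a) For each integer $k$ with $2\le k\le n-2$: $\bigwedge^{k}G$ is balanced if and only if either $G$ is a path, or $G$ is a cycle and $k$ is odd. (b) For $k=n-1$ (with $n\ge 2$): $\bigwedge^{n-1}G$ is balanced if and only if $G$ is bipartite.
   Context: A signed graph is a graph together with a map assigning $\pm1$ to each edge. The sign of a cycle is the product of the signs of its edges. A signed graph is balanced if all of its cycles are positive. Exterior power of an unsigned graph: let $G=(V,E)$ have $n$ vertices and $1\le k\le n-1$. Fix a total order $\prec$ on $V$. The vertex set of $\bigwedge^{k}G$ is $\binom{V}{k}$, the set of $k$-tuples $(u_1,\dots,u_k)\in V^k$ with $u_1\prec\cdots\prec u_k$. Two vertices $u=(u_1,\dots,u_k)$ and $v=(v_1,\dots,v_k)$ are adjacent iff there are a permutation $\pi$ of $\{1,\dots,k\}$ and an index $i$ such that $u_{\pi(j)}=v_j$ for all $j\ne i$ and $u_{\pi(i)}v_i\in E(G)$. The sign of the edge $uv$ is $\operatorname{sgn}(\pi)$. The statement is meant for any choice of the order $\prec$. *)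

(* Defs.v *)
From HB Require Import structures.
From mathcomp Require Import all_boot all_order all_algebra all_fingroup.

Set Implicit Arguments.
Unset Strict Implicit.
Unset Printing Implicit Defensive.

Import Order.TTheory GRing.Theory Num.Theory.

Record simple_graph (V : finType) := SimpleGraph {
  adj :> rel V;
  adj_sym : symmetric adj;
  adj_irr : irreflexive adj
}.

(* Signs are recorded on ordered pairs; only the values on edges matter. *)
Record signed_graph (V : finType) := SignedGraph {
  underlying :> simple_graph V;
  sign : V -> V -> int;
  sign_sym : forall x y, underlying x y -> sign x y = sign y x;
  sign_pm1 : forall x y, underlying x y -> sign x y = 1%R \/ sign x y = (-1)%R
}.

Section Graphs.
Variables (V : finType) (G : simple_graph V).

Definition connected_graph : Prop := forall x y : V, connect G x y.

Definition is_path_graph : Prop :=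
  exists2 f : 'I_#|V| -> V, bijective f &
    forall i j : 'I_#|V|, G (f i) (f j) = (i.+1 == j) || (j.+1 == i).

Definition is_cycle_graph : Prop :=
  2 < #|V| /\
  exists2 f : 'I_#|V| -> V, bijective f &
    forall i j : 'I_#|V|,
      G (f i) (f j) = (i.+1 %% #|V| == j) || (j.+1 %% #|V| == i).

Definition bipartite : Prop :=
  exists c : V -> bool, forall x y, G x y -> c x != c y.

(* A cycle of G, as the cyclic sequence of its pairwise distinct vertices.
   [ucycle] alone also accepts lengths 0 and 2. *)
Definition graph_cycle (s : seq V) : Prop := ucycle G s /\ 2 < size s.

End Graphs.

Definition cycle_sign (V : finType) (S : signed_graph V) (s : seq V) : int :=
  (\prod_(x <- s) sign S x (next s x))%R.

Definition balanced (V : finType) (S : signed_graph V) : Prop :=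
  forall s : seq V, graph_cycle S s -> cycle_sign S s = 1%R.

Section ExteriorPower.
Context {d : Order.disp_t} {V : finOrderType d}.
Variables (G : simple_graph V) (k : nat).

Definition ext_vertex : finType := {u : k.-tuple V | sorted <%O u}.

Implicit Types (u v : ext_vertex) (p q : 'S_k) (i j m : 'I_k).

Definition ext_link u v (p : 'S_k) (i : 'I_k) : bool :=
  [forall j, (j != i) ==> (tnth (val u) (p j) == tnth (val v) j)]
  && G (tnth (val u) (p i)) (tnth (val v) i).

Definition ext_adj : rel ext_vertex :=
  fun u v => [exists p : 'S_k, exists i : 'I_k, ext_link u v p i].

(* On an edge the permutation is unique: see [ext_link_uniq] and
   [ext_signE] below.  The value 1 off the edges is irrelevant. *)
Definition ext_sign u v : int :=
  if [pick p : 'S_k | [exists i : 'I_k, ext_link u v p i]] is Some p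
  then ((-1) ^+ odd_perm p)%R else 1%R.

Lemma ext_vertex_inj u : injective (tnth (val u)).
Proof.
have /tuple_uniqP // : uniq (val u).
by apply: (sorted_uniq lt_trans ltxx); exact: (valP u).
Qed.

Lemma ext_linkP u v p i :
  reflect ((forall j, j != i -> tnth (val u) (p j) = tnth (val v) j)
           /\ G (tnth (val u) (p i)) (tnth (val v) i))
          (ext_link u v p i).
Proof.
apply: (iffP andP) => -[h ?]; split=> //.
  by move=> j ji; apply/eqP; move/forallP/(_ j)/implyP: h; apply.
by apply/forallP => j; apply/implyP => ji; rewrite h.
Qed.

Lemma ext_link_inv u v p i :
  ext_link u v p i -> ext_link v u p^-1%g (p i).
Proof.
move=> /ext_linkP[h g]; apply/ext_linkP; split.
  move=> j ji; rewrite -h ?permKV //; apply: contra ji => /eqP <-.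
  by rewrite permKV.
by rewrite permK adj_sym.
Qed.

(* The entry of u that is moved is not an entry of v. *)
Lemma ext_link_moved u v p i m :
  ext_link u v p i -> tnth (val u) (p i) <> tnth (val v) m.
Proof.
move=> /ext_linkP[h g]; have [-> e | mi] := eqVneq m i.
  by rewrite e adj_irr in g.
by rewrite -h // => /ext_vertex_inj/perm_inj e; rewrite e eqxx in mi.
Qed.

Lemma ext_link_uniq u v p q i j :
  ext_link u v p i -> ext_link u v q j -> p = q /\ i = j.
Proof.
move=> lp lq; have [hp _] := ext_linkP _ _ _ _ lp.
have [hq _] := ext_linkP _ _ _ _ lq.
have pq : p i = q j.
  have [e | ne] := eqVneq (q^-1 (p i))%g j; first by rewrite -e permKV.
  by case: (ext_link_moved (m := (q^-1 (p i))%g) lp); rewrite -hq // permKV.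
have ij : i = j.
  apply/eqP/negPn/negP => nij.
  have e := hq _ nij.
  have [e' | ne] := eqVneq (p^-1 (q i))%g i.
    by have := ext_link_moved (m := i) lp; rewrite -{1}e' permKV.
  by move: (hp _ ne); rewrite permKV e => /ext_vertex_inj e'; rewrite -e' eqxx in ne.
split=> //; apply/permP => m; have [-> | mi] := eqVneq m i; first by rewrite pq ij.
by apply: (@ext_vertex_inj u); rewrite hp // hq // -ij.
Qed.

Lemma ext_signE u v p i :
  ext_link u v p i -> ext_sign u v = ((-1) ^+ odd_perm p)%R.
Proof.
move=> l; rewrite /ext_sign; case: pickP => [q /existsP[j lq] | /(_ p)].
  by have [-> _] := ext_link_uniq l lq.
by move=> /existsP; case; exists i.
Qed.

Lemma ext_adjP u v :
  reflect (exists p i, ext_link u v p i) (ext_adj u v).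
Proof.
apply: (iffP existsP) => -[p]; first by move=> /existsP[i]; exists p, i.
by case=> i l; exists p; apply/existsP; exists i.
Qed.

Lemma ext_adj_sym : symmetric ext_adj.
Proof.
by move=> u v; apply/ext_adjP/ext_adjP => -[p [i /ext_link_inv l]];
  exists p^-1%g, (p i).
Qed.

Lemma ext_adj_irr : irreflexive ext_adj.
Proof.
by move=> u; apply/ext_adjP => -[p [i l]]; exact: (ext_link_moved (m := p i) l).
Qed.

Definition ext_graph : simple_graph ext_vertex :=
  SimpleGraph ext_adj_sym ext_adj_irr.

Lemma ext_sign_sym u v : ext_graph u v -> ext_sign u v = ext_sign v u.
Proof.
move=> /ext_adjP[p [i l]].
by rewrite (ext_signE l) (ext_signE (ext_link_inv l)) odd_permV.
Qed.

Lemma ext_sign_pm1 u v :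
  ext_graph u v -> ext_sign u v = 1%R \/ ext_sign u v = (-1)%R.
Proof.
move=> /ext_adjP[p [i l]]; rewrite (ext_signE l).
by case: (odd_perm p); [right | left].
Qed.

Definition exterior_power : signed_graph ext_vertex :=
  SignedGraph ext_sign_sym ext_sign_pm1.

End ExteriorPower.

(* Main.v *)
Require Import Defs.
From HB Require Import structures.
From mathcomp Require Import all_boot all_order all_algebra all_fingroup.
From mathcomp Require Import zify.

(** A vertex of the [k]th exterior power is a set of [k] tokens on distinct
    vertices of [G], an edge moves one token along an edge of [G] to a free
    vertex, and the sign of the edge compares the sorted order of the tokens
    before and after the move.  So the sign of a closed walk is the signature of
    the permutation that it induces on labelled tokens, and the exterior power
    is balanced exactly when no sequence of moves brings the tokens back
    permuted oddly.

    This becomes usable in the following form.  A signed graph is balanced iff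
    its signs come from a potential, a two-colouring [s] such that the sign of
    [xy] is [(-1) ^ (s x + s y)] ([balancedP]).  For the exterior power, a
    potential is the same thing as a boolean function of the labelled
    configurations, that is, of the injections of ['I_k] into [V], which is
    constant under moves and picks up the signature when the labels are
    permuted: an [alternating_invariant] ([balanced_exteriorP]).  The order
    chosen on the vertices has disappeared from this condition.

    Suppose that [2 <= k <= n - 2].  If a vertex has three neighbours, then two
    tokens on two of them can be exchanged through that vertex and the third
    neighbour while all others rest, so there is no invariant
    ([invariant_claw_free]).  A connected graph without such a vertex is a path
    or a cycle ([claw_free_path_or_cycle]).  On a path, tokens cannot overtake
    each other, so the parity of the number of inversions with respect to the
    order along the path is an invariant.  On a cycle, the only further move
    carries the first token behind all the others or the last one before them,
    which changes [k - 1] inversions: the parity survives if [k] is odd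
    ([position_parity_invariant]), while if [k] is even, turning all tokens one
    place is an odd permutation ([closed_line_invariant_odd]).

    Suppose that [k = n - 1].  There is one free vertex, the hole, and a move
    exchanges the hole with a token.  If the hole counts as one more label, each
    move is a transposition.  Hence an invariant differs from the parity of the
    completed configuration by a function of the hole that changes along every
    edge of [G], which is a two-colouring; and conversely
    ([bipartite_invariant], [invariant_bipartite]). *)

Set Implicit Arguments.
Unset Strict Implicit.
Unset Printing Implicit Defensive.

Import Order.TTheory GRing.Theory Num.Theory.

(** * Balance and potentials *)

Section Balance.
Local Open Scope ring_scope.
Variables (T : finType) (S : signed_graph T).

Definition walk_sign x p : int := \prod_(e <- pairmap (sign S) x p) e.

Lemma walk_sign_cat x p q :
  walk_sign x (p ++ q) = walk_sign x p * walk_sign (last x p) q.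
Proof. by rewrite /walk_sign pairmap_cat big_cat. Qed.

Lemma walk_sign_cons x y p :
  walk_sign x (y :: p) = sign S x y * walk_sign y p.
Proof. by rewrite /walk_sign big_cons. Qed.

Lemma walk_sign_nil x : walk_sign x [::] = 1.
Proof. exact: big_nil. Qed.

Lemma walk_sign_sq x p : path S x p -> walk_sign x p * walk_sign x p = 1.
Proof.
elim: p x => [|y p IHp] x /=; first by rewrite walk_sign_nil mulr1.
case/andP=> xy /IHp yp; rewrite walk_sign_cons mulrACA yp mulr1.
by case: (sign_pm1 xy) => ->.
Qed.

(** Cycles and walks meet in the closed walk that starts at the head of the
    cyclic sequence and returns to it. *)
Lemma cycle_sign_walk x q :
  uniq (x :: q) -> cycle_sign S (x :: q) = walk_sign x (rcons q x).
Proof.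
move=> Uxq; rewrite /cycle_sign /walk_sign [LHS](big_nth x) [RHS](big_nth 1).
rewrite size_pairmap size_rcons; apply: eq_big_nat => i /andP[_ lt_i].
rewrite (nth_pairmap x) ?size_rcons // next_nth mem_nth ?index_uniq //.
rewrite -rcons_cons !nth_rcons lt_i; congr (sign S _ _).
by case: ltngtP => // [lt | ->]; rewrite nth_default // ltnW.
Qed.

Lemma not_uniq_split (s : seq T) :
  ~~ uniq s -> exists z s1 s2 s3, s = s1 ++ z :: s2 ++ z :: s3.
Proof.
elim: s => //= x s IHs; case: (boolP (x \in s)) => [/splitPr[s1 s2] _ | _ /IHs].
  by exists x, [::], s1, s2.
by case=> z [s1 [s2 [s3 ->]]]; exists z, (x :: s1), s2, s3.
Qed.

(** A closed walk that repeats a vertex splits there into two shorter closed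
    walks.  The pieces that do not split are empty, or cycles, or run back and
    forth along one edge, which counts its sign twice. *)
Lemma balanced_closed_walk x p :
  balanced S -> path S x p -> last x p = x -> walk_sign x p = 1.
Proof.
move=> balS; have [n] := ubnP (size p); elim: n => // n IHn in x p *.
rewrite ltnS => le_p_n xp lxp; case: (boolP (uniq p)) => [Up | /not_uniq_split].
  case: (lastP p) => [|q y] in le_p_n xp lxp Up *; first exact: walk_sign_nil.
  move: lxp; rewrite last_rcons => eyx; subst y; have Uxq : uniq (x :: q).
    by move: Up; rewrite rcons_uniq.
  rewrite -cycle_sign_walk //; case: q => [|y [|z q]] in xp Uxq le_p_n Up *.
  - by move: xp; rewrite /= adj_irr.
  - case/and3P: xp => xy yx _.
    rewrite cycle_sign_walk //= !walk_sign_cons walk_sign_nil mulr1.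
    by rewrite (sign_sym yx); case: (sign_pm1 xy) => ->.
  by apply: balS; split=> //; apply/andP.
case=> z [s1 [s2 [s3 def_p]]]; subst p; move: xp lxp le_p_n.
rewrite cat_path last_cat /= cat_path last_cat /= size_cat /= size_cat /=.
move=> /and5P[xs1 s1z zs2 s2z zs3] lxp le_n.
rewrite walk_sign_cat walk_sign_cons walk_sign_cat walk_sign_cons.
have -> : walk_sign z s2 * (sign S (last z s2) z * walk_sign z s3)
        = walk_sign z (rcons s2 z) * walk_sign z s3.
  by rewrite -cats1 walk_sign_cat walk_sign_cons walk_sign_nil mulr1 mulrA.
rewrite (IHn z (rcons s2 z)) ?last_rcons ?rcons_path ?zs2 ?size_rcons //;
  last by lia.
rewrite mul1r -walk_sign_cons -walk_sign_cat; apply: IHn.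
- by rewrite size_cat /=; lia.
- by rewrite cat_path /= xs1 s1z.
- by rewrite last_cat.
Qed.

(** The potential of a vertex is the sign of some walk to it from a root of its
    component; balance makes the choice of the walk immaterial. *)
Lemma balancedP :
  balanced S <->
  exists s : T -> bool,
    forall x y, S x y -> sign S x y = (-1) ^+ (s x (+) s y).
Proof.
split=> [balS | [s sE] c [/andP[cyc Uc] _]]; last first.
  case: c => [|x q] in cyc Uc *; first by rewrite /cycle_sign big_nil.
  rewrite cycle_sign_walk //; move: cyc => /=.
  have walkE y p : path S y p -> walk_sign y p = (-1) ^+ (s y (+) s (last y p)).
    elim: p y => [|z p IHp] y /=; first by rewrite walk_sign_nil addbb.
    case/andP=> yz /IHp; rewrite walk_sign_cons => ->.
    rewrite sE // -signr_addb.
    by rewrite addbA addbK.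
  by move/walkE->; rewrite last_rcons addbb.
have csym : connect_sym S by apply: sym_connect_sym; exact: adj_sym.
have /fin_all_exists[w wP] x :
    exists p, path S (fingraph.root S x) p /\ last (fingraph.root S x) p = x.
  have: connect S (fingraph.root S x) x by rewrite csym connect_root.
  by case/connectP=> p; exists p.
pose t x := walk_sign (fingraph.root S x) (w x).
have tt x : t x * t x = 1 by apply: walk_sign_sq; case: (wP x).
exists (fun x => t x == -1) => x y xy.
have exy : fingraph.root S x = fingraph.root S y.
  by apply/eqP; rewrite root_connect // connect1.
suff -> : sign S x y = t x * t y.
  have tE z : t z = (-1) ^+ (t z == -1).
    have: (t z - 1) * (t z + 1) = 0 by move: (tt z); lia.
    by move/eqP; rewrite mulf_eq0 subr_eq0 addr_eq0 => /orP[] /eqP ->.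
  by rewrite signr_addb -!tE.
have /connectP[q yq lq] : connect S y (fingraph.root S y).
  exact: connect_root.
have [px lx] := wP x; have [py ly] := wP y.
(* Closing up the walks to [y] and to [x] followed by [xy] with the same return
   walk [q] gives [sign xy * t x = t y] without reversing any walk. *)
have wq : t y * walk_sign y q = 1.
  have := @balanced_closed_walk (fingraph.root S y) (w y ++ q) balS.
  by rewrite cat_path last_cat walk_sign_cat ly -lq; apply; rewrite ?py.
have wxq : t x * (sign S x y * walk_sign y q) = 1.
  have := @balanced_closed_walk (fingraph.root S x) (w x ++ y :: q) balS.
  rewrite cat_path last_cat walk_sign_cat lx /= walk_sign_cons -lq px xy yq.
  by apply; rewrite // exy.
have qq := walk_sign_sq yq; move: (tt x) => ttx.
have <- : walk_sign y q = t y by rewrite -[LHS]mul1r -(tt y) -mulrA wq mulr1.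
by rewrite -[RHS]mulr1 -wxq mulrACA ttx mul1r mulrCA qq mulr1.
Qed.
End Balance.

(** * Parity of the number of inversions *)

Definition inversion_parity k (h : 'I_k -> nat) : bool :=
  \big[addb/false]_(i < k) \big[addb/false]_(j < k | i < j) (h j < h i).

(** The sign of the Vandermonde determinant of [h] is the inversion parity of
    [h], and the determinant is alternating in its columns. *)
Lemma inversion_parity_perm k (h : 'I_k -> nat) (t : 'S_k) :
  injective h -> inversion_parity (h \o t) = inversion_parity h (+) t.
Proof.
pose a g : 'rV[int]_k := (\row_i (g i : nat)%:Z)%R.
have sgE g : injective g ->
    ((-1) ^+ inversion_parity g = Num.sg (\det (Vandermonde k (a g))) :> int)%R.
  move=> injg; rewrite det_Vandermonde /inversion_parity.
  rewrite (big_morph _ (@signr_addb _) (erefl _)).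
  rewrite (big_morph _ (@sgrM _) (@sgr1 _)); apply: eq_bigr => i _.
  rewrite (big_morph _ (@signr_addb _) (erefl _)).
  rewrite (big_morph _ (@sgrM _) (@sgr1 _)); apply: eq_bigr => j lt_ij.
  rewrite !mxE; case: ltngtP => [lt | lt | /injg e].
  - by rewrite ltr0_sg ?subr_lt0 ?ltz_nat.
  - by rewrite gtr0_sg ?subr_gt0 ?ltz_nat.
  - by rewrite e ltnn in lt_ij.
move=> injh; apply: (@signr_inj int); rewrite signr_addb !sgE //; last first.
  by apply: inj_comp => //; exact: perm_inj.
have -> : Vandermonde k (a (h \o t)) = col_perm t (Vandermonde k (a h)).
  by apply/matrixP=> i j; rewrite !mxE.
rewrite col_permE det_mulmx det_perm odd_permV sgrM; congr (_ * _)%R.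
by case: (odd_perm t); rewrite ?expr0 ?expr1 ?sgr1 ?sgrN1.
Qed.

Lemma eq_inversion_parity k (h h' : 'I_k -> nat) :
  (forall i j : 'I_k, i < j -> (h j < h i) = (h' j < h' i)) ->
  inversion_parity h = inversion_parity h'.
Proof.
by move=> e; apply: eq_bigr => i _; apply: eq_bigr => j /e.
Qed.

(** No other value lies between [h m] and [(h m).+1], so no comparison
    changes. *)
Lemma inversion_parity_step k (h h' : 'I_k -> nat) (m : 'I_k) :
  injective h -> injective h' -> (forall i, i != m -> h i = h' i) ->
  h' m = (h m).+1 -> inversion_parity h = inversion_parity h'.
Proof.
move=> injh injh' eh hm; apply: eq_inversion_parity => i j lt_ij.
have neq (g : 'I_k -> nat) : injective g -> g i != g j.
  by move=> injg; apply: contraTneq lt_ij => /injg ->; rewrite ltnn.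
have:= neq _ injh; have:= neq _ injh'.
have [ei | ni] := eqVneq i m; have [ej | nj] := eqVneq j m.
- by subst; rewrite ltnn in lt_ij.
- by rewrite ei hm (eh j) //; lia.
- by rewrite ej hm (eh i) //; lia.
- by rewrite !eh.
Qed.

(** Exactly the [k.-1] pairs that contain [m] change their order. *)
Lemma inversion_parity_wrap k (h h' : 'I_k -> nat) (m : 'I_k) :
  (forall i, i != m -> h i = h' i) ->
  (forall i, i != m -> h i < h m) -> (forall i, i != m -> h' m < h' i) ->
  inversion_parity h' = inversion_parity h (+) odd k.-1.
Proof.
move=> eh hmax hmin; apply: (canRL (addKb _)).
rewrite /inversion_parity -big_split /=.
rewrite (eq_bigr (fun i : 'I_k =>
    \big[addb/false]_(j < k | i < j) ((i == m) || (j == m)))); last first.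
  move=> i _; rewrite -big_split; apply: eq_bigr => j lt_ij /=.
  have [ei | ni] := eqVneq i m; have [ej | nj] := eqVneq j m.
  - by subst; rewrite ltnn in lt_ij.
  - by rewrite ei hmax // ltnNge ltnW ?hmin.
  - by rewrite ej hmin // ltnNge ltnW ?hmax.
  - by rewrite !eh // addbb.
(* Each [i] other than [m] counts once: in its own row if [i < m], in the row
   of [m] if [m < i]. *)
rewrite (bigD1 m) //= (eq_bigr (fun=> true)) => [|j _]; last by rewrite eqxx.
have -> : \big[addb/false]_(j < k | m < j) true
        = \big[addb/false]_(j < k | j != m) (m < j).
  rewrite big_mkcond [RHS]big_mkcond; apply: eq_bigr => j _.
  by have [->|] := eqVneq j m; rewrite ?ltnn //; case: (m < j).
rewrite -big_split (eq_bigr (fun=> odd 1)) => [|i ni]; last first.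
  rewrite /= (negbTE ni) /= big_mkcond (bigD1 m) //= eqxx.
  rewrite big1 ?addbF => [|j nj].
    by case: ltngtP ni => // /val_inj ->; rewrite eqxx.
  by rewrite (negbTE nj) if_same.
rewrite -(big_morph odd oddD (erefl : odd 0 = false)) sum1_card.
by rewrite cardC1 card_ord.
Qed.

(** * Labelled tokens and the exterior power *)

Section Tokens.
Variables (V : finType) (G : simple_graph V) (k : nat).

(** The target is free as soon as [g] is injective, and this is assumed wherever
    moves are used. *)
Definition token_move (f g : {ffun 'I_k -> V}) : Prop :=
  exists2 i, (forall j, j != i -> f j = g j) & G (f i) (g i).

(** Only injective [f] can be alternating: swapping two labels on the same
    vertex does not change [f]. *)
Definition alternating_invariant (chi : {ffun 'I_k -> V} -> bool) : Prop :=
  (forall (f : {ffun 'I_k -> V}) (t : 'S_k),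
     injective f -> chi [ffun i => f (t i)] = chi f (+) t) /\
  (forall f g : {ffun 'I_k -> V},
     injective f -> injective g -> token_move f g -> chi f = chi g).

End Tokens.

Lemma perm_of_image k (V : eqType) (f g : 'I_k -> V) :
  injective g -> (forall i, exists j, g i = f j) ->
  exists t : 'S_k, forall i, g i = f (t i).
Proof.
move=> injg /fin_all_exists[t tP].
have injt : injective t by move=> i j e; apply: injg; rewrite !tP e.
by exists (perm injt) => i; rewrite permE.
Qed.

Section ExteriorInvariant.
Context {d : Order.disp_t} {V : finOrderType d}.
Variables (G : simple_graph V) (k : nat).

Lemma ffun_sortP (f : {ffun 'I_k -> V}) : injective f ->
  exists w : ext_vertex k * 'S_k, forall i, f i = tnth (val w.1) (w.2 i).
Proof.
move=> injf; pose s := sort <=%O (codom f).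
have size_s : size s == k by rewrite size_sort size_codom card_ord.
have sorted_s : sorted <%O (Tuple size_s).
  by rewrite /= sort_lt_sorted; apply/injectiveP.
pose u : ext_vertex k := exist _ (Tuple size_s) sorted_s.
have [i | t tP] := perm_of_image (f := tnth (val u)) injf;
  last by exists (u, t).
by apply/tnthP; rewrite /= mem_sort codom_f.
Qed.

Lemma ffun_sort_uniq (f : {ffun 'I_k -> V}) (w w' : ext_vertex k * 'S_k) :
  (forall i, f i = tnth (val w.1) (w.2 i)) ->
  (forall i, f i = tnth (val w'.1) (w'.2 i)) -> w = w'.
Proof.
case: w w' => [u p] [v q] /= fu fv.
have mem_u (u' : ext_vertex k) (p' : 'S_k) :
    (forall i, f i = tnth (val u') (p' i)) -> val u' =i codom f.
  move=> fu' x; apply/tnthP/codomP => -[i ->].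
    by exists (p'^-1 i)%g; rewrite fu' permKV.
  by exists (p' i).
have euv : u = v.
  apply/val_inj/val_inj/(irr_sorted_eq lt_trans ltxx (valP u) (valP v)) => x.
  by rewrite (mem_u u p) // (mem_u v q).
subst v; congr (_, _); apply/permP => i.
by apply: (@ext_vertex_inj _ _ _ u); rewrite -fu -fv.
Qed.

(** A labelled configuration is a set of occupied vertices together with a
    permutation of the sorted order.  A potential of the set plus the
    signature of the permutation gives an invariant, since the sign of an edge
    compares the two permutations; the values of an invariant on sorted
    configurations give back a potential. *)
Lemma balanced_exteriorP :
  balanced (exterior_power G k) <->
  exists chi : {ffun 'I_k -> V} -> bool, alternating_invariant G chi.
Proof.
rewrite balancedP; split=> [[s sE] | [chi [chiP chiM]]]; last first.
  exists (fun u => chi [ffun j => tnth (val u) j]) => u v /ext_adjP[p [i l]].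
  rewrite /= (ext_signE l); have [h g] := ext_linkP _ _ _ _ _ l.
  have inju (w : @ext_vertex d V k) :
      injective [ffun j : 'I_k => tnth (val w) j].
    by move=> a b; rewrite !ffunE; exact: ext_vertex_inj.
  have <- : chi [ffun j => [ffun j => tnth (val u) j] (p j)]
         = chi [ffun j => tnth (val v) j].
    apply: chiM => //.
      by move=> a b; rewrite !ffunE => /ext_vertex_inj/perm_inj.
    by exists i => [j ji|]; rewrite !ffunE // h.
  by rewrite chiP // addKb.
pose chi (f : {ffun 'I_k -> V}) :=
  if [pick w : ext_vertex k * 'S_k |
       [forall i, f i == tnth (val w.1) (w.2 i)]] is Some w
  then s w.1 (+) w.2 else false.
have chiE (f : {ffun 'I_k -> V}) (u : ext_vertex k) (p : 'S_k) :
    (forall i, f i = tnth (val u) (p i)) -> chi f = s u (+) p.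
  move=> fu; rewrite /chi; case: pickP => [w /forallP fw | /(_ (u, p))].
    by rewrite (@ffun_sort_uniq f w (u, p)) // => i; apply/eqP.
  by case/forallP=> i; rewrite fu.
exists chi; split=> [f t | f g] injf; have [[u p] /= fu] := ffun_sortP injf.
  rewrite (chiE _ _ _ fu) (chiE _ u (t * p)%g) => [|i];
    last by rewrite ffunE permM.
  by rewrite odd_permM addbA addbAC.
case/ffun_sortP=> -[v q] /= gv [i h e].
have l : ext_link G u v (q^-1 * p)%g (q i).
  apply/ext_linkP; split=> [j ji|]; last by rewrite permM permK -fu -gv.
  rewrite permM -fu h ?gv ?permKV //.
  by apply: contra ji => /eqP <-; rewrite permKV.
have uv : exterior_power G k u v by apply/ext_adjP; exists (q^-1 * p)%g, (q i).
have := sE _ _ uv; rewrite /= (ext_signE l) => /signr_inj.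
rewrite odd_permM odd_permV (chiE _ _ _ fu) (chiE _ _ _ gv).
by case: (s u) (s v) (odd_perm p) (odd_perm q) => [] [] [] [].
Qed.

End ExteriorInvariant.

(** * Graphs without a vertex of degree three *)

(** The three leaves may be adjacent to each other, so this says that every
    degree is at most two. *)
Definition claw_free (V : finType) (G : simple_graph V) : Prop :=
  forall c a1 a2 a3 : V,
    G c a1 -> G c a2 -> G c a3 -> uniq [:: a1; a2; a3] -> False.

(** Tokens [0] and [1] on two leaves of the claw exchange their places in six
    moves, using the centre and the third leaf; the bounds on [k] provide both
    tokens and leave those two vertices free. *)
Lemma invariant_claw_free (V : finType) (G : simple_graph V) k
    (chi : {ffun 'I_k -> V} -> bool) :
  2 <= k -> k <= #|V| - 2 -> alternating_invariant G chi -> claw_free G.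
Proof.
case: k chi => [|[|k]] // chi _ le_k [chiP chiM] c a1 a2 a3 ca1 ca2 ca3 Ua.
pose claw := [:: c; a1; a2; a3].
have Uclaw : uniq claw.
  rewrite /claw cons_uniq Ua andbT !inE.
  by apply/negP => /or3P[] /eqP e; subst c; rewrite adj_irr in ca1 ca2 ca3.
pose others := take k (enum [predC claw]).
have size_others : size others = k.
  have: #|claw| + #|[predC claw]| = #|V| := cardC (mem claw).
  rewrite (card_uniqP Uclaw) -[size claw]/4 => eqV.
  by rewrite size_takel // -cardE -(leq_add2l 4) [X in _ <= X]eqV; lia.
pose conf x y : {ffun 'I_k.+2 -> V} :=
  [ffun j : 'I_k.+2 => nth c [:: x, y & others] j].
have Uconf x y : x \in claw -> y \in claw -> x != y -> uniq [:: x, y & others].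
  have others_claw z : z \in claw -> z \notin others.
    by move=> z_claw; apply/negP => /mem_take; rewrite mem_enum => /negP.
  move=> xc yc nxy; rewrite !cons_uniq in_cons (negbTE nxy) !others_claw //=.
  exact/take_uniq/enum_uniq.
have inj_conf x y : x \in claw -> y \in claw -> x != y -> injective (conf x y).
  move=> xc yc nxy i j; rewrite !ffunE => /eqP.
  by rewrite nth_uniq ?Uconf //= ?size_others ?ltn_ord // => /eqP/val_inj.
have move0 x x' y : x \in claw -> x' \in claw -> y \in claw ->
    x != y -> x' != y -> G x x' -> chi (conf x y) = chi (conf x' y).
  move=> xc xc' yc nxy nxy' xx'; apply: chiM; [exact: inj_conf..|].
  exists ord0; last by rewrite !ffunE.
  by case=> [[|j] lt_j] // _; rewrite !ffunE.
have move1 x y y' : x \in claw -> y \in claw -> y' \in claw ->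
    x != y -> x != y' -> G y y' -> chi (conf x y) = chi (conf x y').
  move=> xc yc yc' nxy nxy' yy'; apply: chiM; [exact: inj_conf..|].
  exists (inord 1); last by rewrite !ffunE inordK.
  case=> [[|[|j]] lt_j] // nj; rewrite !ffunE //.
  by case/eqP: nj; apply: val_inj; rewrite /= inordK.
move: (Uclaw); rewrite /= !inE !negb_or !andbT -!andbA.
move=> /and5P[n1 n2 n3 n4 /andP[n5 n6]].
have m0 : c \in claw by rewrite !inE eqxx.
have m1 : a1 \in claw by rewrite !inE eqxx ?orbT.
have m2 : a2 \in claw by rewrite !inE eqxx ?orbT.
have m3 : a3 \in claw by rewrite !inE eqxx ?orbT.
have swap : conf a2 a1 = [ffun i => conf a1 a2 (tperm ord0 (inord 1) i)].
  apply/ffunP=> i; rewrite !ffunE; case: tpermP => [-> | -> | ].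
  - by rewrite inordK.
  - by rewrite inordK.
  case: i => [[|[|j]] lt_j] //= h0 h1; first by case: h0; apply: val_inj.
  by case: h1; apply: val_inj; rewrite /= inordK.
(* The successive places of tokens [0] and [1] are
   a1 a2, c a2, a3 a2, a3 c, a3 a1, c a1, a2 a1. *)
have: chi (conf a1 a2) = chi (conf a2 a1).
  rewrite (@move0 a1 c) ?(@move0 c a3) // 1?adj_sym // 1?eq_sym //.
  rewrite (@move1 a3 a2 c) ?(@move1 a3 c a1) // 1?adj_sym // 1?eq_sym //.
  rewrite (@move0 a3 c) ?(@move0 c a2) // 1?adj_sym // 1?eq_sym //.
rewrite swap chiP; last exact: inj_conf.
rewrite odd_tperm; have -> : ord0 != inord 1 :> 'I_k.+2.
  by rewrite -val_eqE /= inordK.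
by case: (chi _).
Qed.

(** A longest path cannot be left from its ends by maximality, nor from its
    inner vertices, which have two neighbours on it already; by connectedness it
    visits every vertex.  The same count of neighbours excludes every further
    edge except one between the two ends. *)
Lemma claw_free_path_or_cycle (V : finType) (G : simple_graph V) :
  connected_graph G -> claw_free G -> 2 < #|V| ->
  is_path_graph G \/ is_cycle_graph G.
Proof.
move=> conG clawG n_gt2.
pose P m := [exists t : m.-tuple V, uniq t && sorted G t].
have P1 : exists m, P m.
  by exists 0; apply/existsP; exists [tuple].
have Pmax m : P m -> m <= #|V|.
  case/existsP=> t /andP[/card_uniqP Ut _].
  by rewrite -[m](size_tuple t) -Ut max_card.
case: (ex_maxnP P1 Pmax) => m /existsP[t /andP[]].
have := size_tuple t; move: {t}(tval t) => s size_s Us Gs max_s.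
have {}max_s r : uniq r -> sorted G r -> size r <= size s.
  rewrite size_s => Ur Gr; apply: max_s.
  by apply/existsP; exists (in_tuple r); rewrite Ur.
have /card_gt0P[x0 _] : 0 < #|V| by lia.
pose a i := nth x0 s i.
have a_inj i j : i < size s -> j < size s -> (a i == a j) = (i == j).
  by move=> *; rewrite nth_uniq.
have a_adj i : i.+1 < size s -> G (a i) (a i.+1).
  by move/sortedP: Gs; apply.
have s_gt0 : 0 < size s by rewrite (max_s [:: x0]).
have s_closed x y : G x y -> x \in s -> y \in s.
  move=> xy xs; apply/negPn/negP => y_s; move: (xy).
  have y_a i : i < size s -> (a i == y) = false.
    by move=> lt_i; apply: contraNF y_s => /eqP <-; rewrite mem_nth.
  rewrite -(nth_index x0 xs) -/(a _); move: (xs); rewrite -index_mem.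
  case: (index x s) => [|i] lt_i ay.
    suff: size (y :: s) <= size s by rewrite ltnn.
    apply: max_s; rewrite /= ?y_s //.
    move: ay Gs; rewrite /a; case: (s) => //= z r zy ->.
    by rewrite adj_sym zy.
  have [lt_i1 | le_i1] := ltnP i.+2 (size s).
    apply: (clawG _ (a i) (a i.+2) y _ _ ay); last 1 first.
    - by rewrite /= !inE !y_a ?a_inj //=; lia.
    - by rewrite adj_sym a_adj.
    - exact: a_adj.
  suff: size (rcons s y) <= size s by rewrite size_rcons ltnn.
  apply: max_s; first by rewrite rcons_uniq y_s.
  have last_s : last x0 s = a i.+1.
    have es : size s = i.+2 by apply/eqP; rewrite eqn_leq le_i1.
    by rewrite -nth_last es.
  case: (s) Gs s_gt0 last_s => //= z r zr _; rewrite rcons_path zr /= => ->.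
  exact: ay.
have s_all y : y \in s.
  have cl : closed G (mem s).
    by apply: (intro_closed (sym_connect_sym (@adj_sym _ G)))
      => x z; exact: s_closed.
  by rewrite -(closed_connect cl (conG (a 0) y)) mem_nth.
have {}size_s : size s = #|V|.
  by rewrite -(card_uniqP Us); apply: eq_card => y; rewrite s_all.
clear P1 Pmax; rewrite {}size_s in a_inj a_adj {s_gt0 max_s s_closed}.
pose f (i : 'I_#|V|) := a i.
have bij_f : bijective f.
  apply: inj_card_bij; last by rewrite card_ord.
  by move=> i j /eqP; rewrite a_inj // => /eqP/val_inj.
have a_far i j : i < j -> j < #|V| -> G (a i) (a j) ->
    j = i.+1 \/ i = 0 /\ j.+1 = #|V|.
  move=> lt_ij lt_j ij; have [|nj] := eqVneq j i.+1; [by left | right].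
  split.
    case: i => // i in lt_ij ij nj *.
    case: (clawG _ (a i) (a i.+2) (a j) _ _ ij).
    - by rewrite adj_sym a_adj //; lia.
    - by apply: a_adj; lia.
    - by rewrite /= !inE !a_inj //; lia.
  have [//|lt_j1] : j.+1 = #|V| \/ j.+1 < #|V| by lia.
  case: j => // j in lt_ij ij nj lt_j lt_j1 *.
  case: (clawG (a j.+1) (a j) (a j.+2) (a i)).
  - by rewrite adj_sym a_adj //; lia.
  - by apply: a_adj; lia.
  - by rewrite adj_sym.
  - by rewrite /= !inE !a_inj //; lia.
case: (boolP (G (a 0) (a #|V|.-1))) => [Gends | nGends]; [right | left].
  split=> //; exists f => // i j; rewrite /f.
  wlog lt_ij : i j / i < j.
    move=> IH; case: (ltngtP i j) => [| lt | /val_inj ->].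
    - exact: IH.
    - by rewrite adj_sym orbC IH.
    - rewrite adj_irr orbb; apply/esym/eqP.
      have [lt | le] := ltnP j.+1 #|V|; first by rewrite modn_small //; lia.
      have -> : j.+1 = #|V| by have := ltn_ord j; lia.
      by rewrite modnn; lia.
  rewrite (@modn_small i.+1); last by have := ltn_ord j; lia.
  apply/idP/orP => [ij | [/eqP <-|]].
  - have [-> | [-> ->]] := a_far _ _ lt_ij (ltn_ord j) ij; first by left.
    by right; rewrite modnn.
  - by rewrite a_adj //; have := ltn_ord j; lia.
  have [lt | le] := ltnP j.+1 #|V|; first by rewrite modn_small //; lia.
  have ej : j.+1 = #|V| by have := ltn_ord j; lia.
  rewrite ej modnn => /eqP <-; rewrite -(_ : #|V|.-1 = j) //; lia.
exists f => // i j; rewrite /f.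
wlog lt_ij : i j / i < j.
  move=> IH; case: (ltngtP i j) => [| lt | /val_inj ->].
  - exact: IH.
  - by rewrite adj_sym orbC IH.
  - by rewrite adj_irr; lia.
apply/idP/orP => [ij | [/eqP <-|]]; last by lia.
- have [-> | [ei ej]] := a_far _ _ lt_ij (ltn_ord j) ij; first by left.
  by case/negP: nGends; rewrite -ej /= -[X in G (a X)]ei.
- by rewrite a_adj //; have := ltn_ord j; lia.
Qed.

(** * Invariants of paths and odd powers of cycles *)

Section PositionInvariant.
Variables (V : finType) (G : simple_graph V) (k : nat) (pos : V -> nat).

Definition position_parity (f : {ffun 'I_k -> V}) : bool :=
  inversion_parity (fun i => pos (f i)).

(** A step forward along a line, or the step from its last to its first place,
    which is allowed only when it keeps the parity. *)
Definition position_succ (x y : V) : Prop :=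
  pos y = (pos x).+1 \/ [/\ odd k, pos y = 0 & forall z, pos z <= pos x].

Lemma position_parity_invariant :
  injective pos ->
  (forall x y, G x y -> position_succ x y \/ position_succ y x) ->
  alternating_invariant G position_parity.
Proof.
move=> inj_pos adjE; have inj_comp_pos (f : {ffun 'I_k -> V}) :
    injective f -> injective (fun i => pos (f i)).
  by move=> injf; exact: inj_comp.
have succ_step (f g : {ffun 'I_k -> V}) m : injective f -> injective g ->
    (forall i, i != m -> f i = g i) -> position_succ (f m) (g m) ->
    position_parity f = position_parity g.
  move=> injf injg fg.
  have efg i : i != m -> pos (f i) = pos (g i) by move=> /fg ->.
  case=> [e | [k_odd g0 fmax]].
    apply: inversion_parity_step efg e; exact: inj_comp_pos.
  have neq (h : {ffun 'I_k -> V}) i :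
      injective h -> i != m -> pos (h i) != pos (h m).
    by move=> injh; apply: contra_neq => /inj_pos/injh.
  rewrite /position_parity (inversion_parity_wrap efg) => [|i ni|i ni].
  - by rewrite (_ : odd k.-1 = false) ?addbF //; lia.
  - by rewrite ltn_neqAle neq ?fmax.
  - by rewrite g0 lt0n -g0 neq.
split=> [f t injf | f g injf injg [m fg /adjE[]]].
- rewrite -inversion_parity_perm; last exact: inj_comp_pos.
  by apply: eq_inversion_parity => i j _; rewrite /= !ffunE.
- exact: succ_step.
- by move=> gf; apply/esym; apply: succ_step gf => // i /fg.
Qed.

End PositionInvariant.

Lemma path_graph_invariant (V : finType) (G : simple_graph V) k :
  is_path_graph G ->
  exists chi : {ffun 'I_k -> V} -> bool, alternating_invariant G chi.
Proof.
case=> f [g fK gK] fG; exists (position_parity (fun x => g x)).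
apply: position_parity_invariant => [|x y].
  by move=> x y /val_inj/(can_inj gK).
rewrite -[x]gK -[y]gK fG /position_succ !fK.
by move=> /orP[] /eqP <-; [left | right]; left.
Qed.

Lemma odd_cycle_graph_invariant (V : finType) (G : simple_graph V) k :
  odd k -> is_cycle_graph G ->
  exists chi : {ffun 'I_k -> V} -> bool, alternating_invariant G chi.
Proof.
move=> k_odd [n_gt2 [f [g fK gK] fG]]; exists (position_parity (fun x => g x)).
apply: position_parity_invariant => [|x y].
  by move=> x y /val_inj/(can_inj gK).
have succP (i j : 'I_#|V|) : i.+1 %% #|V| = j ->
    position_succ k (fun x => g x) (f i) (f j).
  rewrite /position_succ !fK; have [lt_i | le_i] := ltnP i.+1 #|V|.
    by rewrite modn_small // => <-; left.
  have ei : i.+1 = #|V| by apply/eqP; rewrite eqn_leq le_i ltn_ord.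
  by rewrite ei modnn => <-; right; split=> // z; rewrite -ltnS ei.
by rewrite -[x]gK -[y]gK fG => /orP[] /eqP/succP; [left | right].
Qed.

(** * Even powers of cycles *)

Section EvenCycle.
Variables (V : finType) (G : simple_graph V) (c : nat -> V).
Hypothesis c_inj : forall i j, i < #|V| -> j < #|V| -> c i = c j -> i = j.
Hypothesis c_adj : forall i, i.+1 < #|V| -> G (c i) (c i.+1).

Definition line_conf k (h : 'I_k -> nat) : {ffun 'I_k -> V} :=
  [ffun j => c (h j)].

Lemma line_conf_inj k (h : 'I_k -> nat) :
  injective h -> (forall j, h j < #|V|) -> injective (line_conf h).
Proof. by move=> injh lt_h i j; rewrite !ffunE => /c_inj e; exact/injh/e. Qed.

Lemma incr_inj k (h : 'I_k -> nat) :
  (forall i j : 'I_k, i < j -> h i < h j) -> injective h.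
Proof.
move=> incr i j e; apply: val_inj.
by case: (ltngtP i j) => // /incr; rewrite e ltnn.
Qed.

Lemma incr_ge k (h : 'I_k -> nat) :
  (forall i j : 'I_k, i < j -> h i < h j) -> forall i : 'I_k, i <= h i.
Proof.
move=> incr [i lt_i] /=; elim: i lt_i => // i IHi lt_i.
exact: leq_ltn_trans (IHi (ltnW lt_i)) (incr _ _ _).
Qed.

(** Tokens in increasing order can be moved down a line to the places
    [0, ..., k - 1]: the first token that is not in its final place has a free
    place below it. *)
Lemma pack_left k (chi : {ffun 'I_k -> V} -> bool) (h : 'I_k -> nat) :
  alternating_invariant G chi ->
  (forall i j : 'I_k, i < j -> h i < h j) -> (forall j, h j < #|V|) ->
  chi (line_conf h) = chi (line_conf (fun j => j)).
Proof.
case=> _ chiM; have [n] := ubnP (\sum_j h j).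
elim: n h => // n IHn h; rewrite ltnS => le_n incr lt_h.
have [/forallP eh | /forallPn[i0 ni0]] := boolP [forall j, h j == j].
  by congr (chi _); apply/ffunP=> j; rewrite !ffunE (eqP (eh j)).
have [i ni min_i] := @arg_minnP _ i0 (fun i : 'I_k => h i != i) val ni0.
have lt_i : i < h i by rewrite ltn_neqAle eq_sym ni incr_ge.
have low (j : 'I_k) : j < i -> h j = j.
  by move=> lt_ji; apply/eqP; apply: contraLR lt_ji => /min_i; rewrite -leqNgt.
pose h' j := if j == i then (h i).-1 else h j.
have incr' (j l : 'I_k) : j < l -> h' j < h' l.
  move=> lt_jl; rewrite /h'; have [ej | nj] := eqVneq j i.
    have [el | nl] := eqVneq l i; first by rewrite ej el ltnn in lt_jl.
    by apply: leq_ltn_trans (leq_pred _) _; rewrite -ej incr.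
  have [el | nl] := eqVneq l i; last exact: incr.
  by rewrite low -?el //; move: lt_i; rewrite -el; lia.
have lt_h' j : h' j < #|V|.
  by rewrite /h'; case: eqP => // _; apply: leq_ltn_trans (leq_pred _) (lt_h i).
rewrite -(IHn h') //; last first.
  apply: leq_trans le_n; rewrite (bigD1 i) // [X in _ < X](bigD1 i) //=.
  rewrite {1}/h' eqxx (eq_bigr h) => [|j nj]; last by rewrite /h' (negbTE nj).
  by rewrite ltn_add2r prednK //; exact: leq_ltn_trans lt_i.
apply: chiM; try by apply: line_conf_inj => //; exact: incr_inj.
exists i => [j nj|]; rewrite !ffunE /h' ?(negbTE nj) // eqxx adj_sym.
have hi_gt0 : 0 < h i by apply: leq_ltn_trans lt_i.
by have := @c_adj (h i).-1; rewrite prednK //; apply.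
Qed.

(** Compare the inversions of [j |-> j.+1] and of its reduction modulo [k]: only
    the last value wraps around. *)
Lemma odd_rotation k : odd_perm (perm (@ordS_inj k)) = odd k.-1.
Proof.
case: k => [|k].
  have -> : perm (@ordS_inj 0) = 1%g by apply/permP=> -[].
  by rewrite odd_perm1.
have val_incr : forall i j : 'I_k.+1, i < j -> val i < val j by [].
have <- := addKb (inversion_parity (val : 'I_k.+1 -> nat)) (odd_perm _).
rewrite -inversion_parity_perm; last exact: val_inj.
have rotE (i : 'I_k.+1) : (val \o perm (@ordS_inj k.+1)) i = i.+1 %% k.+1.
  by rewrite /= permE.
rewrite (@inversion_parity_wrap _ (fun i => i.+1) (_ \o _) ord_max).
- rewrite addbA (@eq_inversion_parity _ _ (fun i => i.+1)) ?addbb //.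
- move=> i ni; rewrite rotE modn_small // ltnS.
  by move: (ltn_ord i) ni; rewrite -val_eqE /=; lia.
- by move=> i ni; move: (ltn_ord i) ni; rewrite -val_eqE /=; lia.
- move=> i ni; rewrite !rotE /= modnn modn_small // ltnS.
  by move: (ltn_ord i) ni; rewrite -val_eqE /=; lia.
Qed.

(** From the places [0, ..., k - 1], the tokens reach [1, ..., k - 1] and the
    end of the line in the same order, and then the last one wraps around to
    [0].  They return to the same places rotated, so the rotation must be
    even. *)
Lemma closed_line_invariant_odd k (chi : {ffun 'I_k -> V} -> bool) :
  0 < k < #|V| -> G (c #|V|.-1) (c 0) -> alternating_invariant G chi -> odd k.
Proof.
case: k chi => // k chi /= lt_k c_wrap chiI; have [chiP chiM] := chiI.
pose h (j : 'I_k.+1) : nat := if j == ord_max then #|V|.-1 else j.+1.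
have lt_k1 : k < #|V|.-1 by rewrite -ltnS prednK // (leq_trans _ lt_k).
have not_max (j : 'I_k.+1) : j != ord_max -> j < k.
  by rewrite -val_eqE /=; have := ltn_ord j; lia.
have incr_h (i j : 'I_k.+1) : i < j -> h i < h j.
  move=> lt_ij; rewrite /h; have -> : (i == ord_max) = false.
    by apply/negbTE; rewrite -val_eqE /=; have := ltn_ord j; lia.
  case: ifP => // _; rewrite (leq_ltn_trans _ lt_k1) //.
  by rewrite (leq_trans lt_ij) ?leq_ord.
have lt_h j : h j < #|V|.
  by rewrite /h; case: eqP => [_ | /eqP/not_max]; lia.
pose id_conf : {ffun 'I_k.+1 -> V} := line_conf (fun j => j).
have inj_id : injective id_conf.
  by apply: line_conf_inj => [|j]; [exact: val_inj | have := ltn_ord j; lia].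
have := pack_left chiI incr_h lt_h; rewrite -/id_conf.
rewrite (chiM _ [ffun j => id_conf (perm (@ordS_inj k.+1) j)]).
- by rewrite chiP // odd_rotation /=; case: (chi _); case: (odd k).
- by apply: line_conf_inj => //; exact: incr_inj.
- move=> i j; rewrite !ffunE !permE => /c_inj e.
  apply/(@ordS_inj k.+1)/val_inj/e.
    by rewrite (ltn_trans _ lt_k) // ltn_pmod.
  by rewrite (ltn_trans _ lt_k) // ltn_pmod.
exists ord_max => [j nj|]; rewrite !ffunE !permE /= /h.
  by rewrite (negbTE nj) modn_small // ltnS not_max.
by rewrite eqxx modnn.
Qed.

End EvenCycle.

Lemma cycle_graph_invariant_odd (V : finType) (G : simple_graph V) k
    (chi : {ffun 'I_k -> V} -> bool) :
  0 < k < #|V| -> is_cycle_graph G -> alternating_invariant G chi -> odd k.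
Proof.
move=> k_bounds [n_gt2 [f [g fK gK] fG]].
have n_gt0 : 0 < #|V| by lia.
pose c i := f (insubd (Ordinal n_gt0) i).
have cE i (lt_i : i < #|V|) : c i = f (Ordinal lt_i).
  by congr f; apply: val_inj; rewrite val_insubd lt_i.
apply: (@closed_line_invariant_odd _ _ c).
- by move=> i j lt_i lt_j; rewrite !cE => /(can_inj fK)[].
- move=> i lt_i; rewrite (cE _ lt_i) (cE _ (ltnW lt_i)) fG /=.
  by rewrite modn_small // eqxx.
- exact: k_bounds.
have lt_n1 : #|V|.-1 < #|V| by lia.
by rewrite (cE _ lt_n1) (cE _ n_gt0) fG /= prednK // modnn eqxx.
Qed.

(** * A single free vertex *)

Section OneHole.
Variables (V : finType) (G : simple_graph V) (k : nat).
Hypothesis cardV : #|V| = k.+1.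
Implicit Types f g : {ffun 'I_k -> V}.

(** The hole is treated as a token with the additional label [ord0]. *)
Definition with_hole f (x : V) (i : 'I_k.+1) : V := oapp f x (unlift ord0 i).

(** The order of [enum_rank] is arbitrary: any linear order of the vertices
    would do. *)
Definition hole_parity f (x : V) : bool :=
  inversion_parity (fun i => enum_rank (with_hole f x i)).

Lemma with_hole0 f x : with_hole f x ord0 = x.
Proof. by rewrite /with_hole unlift_none. Qed.

Lemma with_hole_lift f x j : with_hole f x (lift ord0 j) = f j.
Proof. by rewrite /with_hole liftK. Qed.

Lemma with_hole_inj f x :
  injective f -> x \notin codom f -> injective (with_hole f x).
Proof.
move=> injf fx i j.
case: (unliftP ord0 i) => [i'|] ->; case: (unliftP ord0 j) => [j'|] ->;
  rewrite ?with_hole0 ?with_hole_lift //.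
- by move/injf->.
- by move=> e; rewrite -e codom_f in fx.
- by move=> e; rewrite e codom_f in fx.
Qed.

Lemma hole_parity_perm f x (s : 'S_k.+1) :
  injective f -> x \notin codom f ->
  inversion_parity (fun i => enum_rank (with_hole f x (s i)))
  = hole_parity f x (+) s.
Proof.
move=> injf fx; rewrite -inversion_parity_perm //.
by move=> i j /val_inj/enum_rank_inj/with_hole_inj; apply.
Qed.

Lemma hole_parity_relabel f x (t : 'S_k) :
  injective f -> x \notin codom f ->
  hole_parity [ffun i => f (t i)] x = hole_parity f x (+) t.
Proof.
move=> injf fx; have := odd_lift_perm ord0 ord0 t; rewrite /= => <-.
rewrite -hole_parity_perm //; apply: eq_inversion_parity => i j _.
suff E l : with_hole [ffun i => f (t i)] x l
         = with_hole f x (lift_perm ord0 ord0 t l).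
  by rewrite !E.
case: (unliftP ord0 l) => [l'|] ->.
  by rewrite lift_perm_lift !with_hole_lift ffunE.
by rewrite lift_perm_id !with_hole0.
Qed.

(** A move is the transposition of the hole and the token [m]. *)
Lemma hole_parity_move f g m :
  injective f -> g m \notin codom f -> (forall i, i != m -> f i = g i) ->
  hole_parity g (f m) = ~~ hole_parity f (g m).
Proof.
move=> injf fgm fg; have := odd_tperm ord0 (lift ord0 m).
rewrite neq_lift -[~~ _]addbT => <-; rewrite -hole_parity_perm //.
apply: eq_inversion_parity => i j _.
suff E l : with_hole g (f m) l = with_hole f (g m) (tperm ord0 (lift ord0 m) l).
  by rewrite !E.
case: (unliftP ord0 l) => [l'|] ->;
  last by rewrite tpermL with_hole0 with_hole_lift.
have [-> | nl] := eqVneq l' m.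
  by rewrite tpermR with_hole0 with_hole_lift.
by rewrite tpermD ?with_hole_lift ?fg // (inj_eq lift_inj) eq_sym.
Qed.

Lemma hole_exists f : exists x, x \notin codom f.
Proof.
apply/existsP; rewrite -negb_forall; apply/negP => /forallP all_f.
have: #|V| <= size (codom f).
  by rewrite cardE uniq_leq_size ?enum_uniq // => x _; rewrite all_f.
by rewrite size_codom card_ord cardV ltnn.
Qed.

Lemma hole_unique f x y :
  injective f -> x \notin codom f -> y \notin codom f -> x = y.
Proof.
move=> injf fx fy; apply/eqP/negPn/negP => nxy.
have U : uniq [:: x, y & codom f].
  by rewrite !cons_uniq in_cons negb_or nxy fx fy; apply/injectiveP.
have := max_card (mem [:: x, y & codom f]).
by rewrite (card_uniqP U) /= size_codom card_ord cardV ltnn.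
Qed.

Lemma token_move_hole f g m :
  injective f -> injective g -> f m != g m -> (forall i, i != m -> f i = g i) ->
  g m \notin codom f.
Proof.
move=> injf injg nfg fg; apply/codomP => -[i e].
have [eim | nim] := eqVneq i m; first by rewrite e eim eqxx in nfg.
by move: e; rewrite (fg _ nim) => /injg e; rewrite e eqxx in nim.
Qed.

(** A move changes both the parity of the completed configuration and the colour
    of the hole. *)
Lemma bipartite_invariant :
  bipartite G ->
  exists chi : {ffun 'I_k -> V} -> bool, alternating_invariant G chi.
Proof.
case=> c cP.
pose hole f := xchoose (hole_exists f).
have holeP f : hole f \notin codom f := xchooseP (hole_exists f).
exists (fun f => hole_parity f (hole f) (+) c (hole f)).
split=> [f t injf | f g injf injg [m fg e]].
  have ft x : (x \notin codom [ffun i => f (t i)]) = (x \notin codom f).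
    congr negb; apply/codomP/codomP => -[i ->].
      by rewrite ffunE; exists (t i).
    by exists ((t^-1)%g i); rewrite ffunE permKV.
  have -> : hole [ffun i => f (t i)] = hole f.
    by apply: (hole_unique injf) => //; rewrite -ft.
  by rewrite hole_parity_relabel // addbAC.
have nfg : f m != g m by apply: contraTneq e => ->; rewrite adj_irr.
have fgm := token_move_hole injf injg nfg fg.
have gfm : f m \notin codom g.
  by apply: token_move_hole => //; [rewrite eq_sym | move=> i /fg].
rewrite (hole_unique injf (holeP f) fgm) (hole_unique injg (holeP g) gfm).
rewrite (hole_parity_move injf fgm fg); move: (cP _ _ e).
by case: (c _) (c _) (hole_parity _ _) => [] [] [].
Qed.

(** The sum of the invariant and of [hole_parity] does not change when the
    labels are permuted, so it depends on the hole only; it changes with every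
    move of the hole. *)
Lemma invariant_bipartite (chi : {ffun 'I_k -> V} -> bool) :
  alternating_invariant G chi -> bipartite G.
Proof.
case=> chiP chiM.
pose std x : {ffun 'I_k -> V} := [ffun j : 'I_k => nth x (enum (predC1 x)) j].
have size_std (x : V) : size (enum (predC1 x)) = k.
  by rewrite -cardE cardC1 cardV.
have std_inj x : injective (std x).
  move=> i j; rewrite !ffunE => /eqP.
  by rewrite nth_uniq ?size_std ?enum_uniq ?ltn_ord // => /eqP/val_inj.
have std_hole x : x \notin codom (std x).
  apply/codomP => -[i]; rewrite ffunE => e.
  have: i < size (enum (predC1 x)) by rewrite size_std.
  by move/(mem_nth x); rewrite -e mem_enum !inE eqxx.
have std_onto x y : y != x -> exists j, y = std x j.
  move=> nyx; have iy : y \in enum (predC1 x) by rewrite mem_enum.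
  have lt_y : index y (enum (predC1 x)) < k by rewrite -(size_std x) index_mem.
  by exists (Ordinal lt_y); rewrite ffunE nth_index.
pose c x := chi (std x) (+) hole_parity (std x) x.
have cE f x :
    injective f -> x \notin codom f -> c x = chi f (+) hole_parity f x.
  move=> injf fx; have [i | t tP] := @perm_of_image _ _ (std x) f injf.
    by apply: std_onto; apply: contraNneq fx => <-; rewrite codom_f.
  have -> : f = [ffun i => std x (t i)].
    by apply/ffunP=> i; rewrite tP [RHS]ffunE.
  by rewrite chiP // hole_parity_relabel // addbAC addbA addbK.
exists c => x y xy.
have nxy : x != y by apply: contraTneq xy => ->; rewrite adj_irr.
have [|m em] := std_onto x y; first by rewrite eq_sym.
pose g : {ffun 'I_k -> V} := [ffun i => if i == m then x else std x i].
have gm : g m = x by rewrite ffunE eqxx.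
have fg i : i != m -> std x i = g i.
  by move=> ni; rewrite [RHS]ffunE (negbTE ni).
have sx i : std x i != x.
  by apply: contraNneq (std_hole x) => e; rewrite -{1}e codom_f.
have injg : injective g.
  move=> i j; have [-> | ni] := eqVneq i m; have [-> | nj] := eqVneq j m => //.
  - by rewrite gm -fg // => e; move: (sx j); rewrite -e eqxx.
  - by rewrite gm -fg // => e; move: (sx i); rewrite e eqxx.
  - by rewrite -!fg // => /std_inj.
have gy : y \notin codom g.
  rewrite em; apply: token_move_hole injg (@std_inj x) _ _.
    by rewrite gm eq_sym.
  by move=> i /fg.
rewrite (cE g y) // /c (chiM _ g) //; last first.
  by exists m => //; rewrite gm -em adj_sym.
have := @hole_parity_move (std x) g m; rewrite gm -em => -> //.
by case: (chi _); case: (hole_parity _ _).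
Qed.

End OneHole.

(** * The criterion for balance *)

Theorem corollary20 (d : Order.disp_t) (V : finOrderType d)
    (G : simple_graph V) (hG : connected_graph G) :
  (forall k : nat, 2 <= k -> k <= #|V| - 2 ->
     (balanced (exterior_power G k) <->
      is_path_graph G \/ (is_cycle_graph G /\ odd k)))
  /\
  (2 <= #|V| ->
     (balanced (exterior_power G (#|V| - 1)) <-> bipartite G)).
Proof.
split=> [k k_ge2 le_k | n_ge2]; rewrite balanced_exteriorP.
  split=> [[chi chiI] | [pathG | [cycG k_odd]]].
  - have clawG := invariant_claw_free k_ge2 le_k chiI.
    have lt_k : k < #|V| by lia.
    have [|pathG|cycG] := claw_free_path_or_cycle hG clawG; [|by left|right].
      exact: leq_ltn_trans k_ge2 lt_k.
    split=> //; apply: cycle_graph_invariant_odd cycG chiI.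
    by apply/andP; split; [exact: ltnW | exact: lt_k].
  - exact: path_graph_invariant.
  - exact: odd_cycle_graph_invariant.
have cardV : #|V| = (#|V| - 1).+1 by lia.
split=> [[chi] | ]; [exact: invariant_bipartite | exact: bipartite_invariant].
Qed.
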